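(* Let $S=\{w_1,\dots,w_k\}$ be a set of words over $\{U,D,H\}$ such that no $w_i$ is a proper (consecutive) subword of another word of $S$. Suppose that every cluster with respect to $S$ reduces to a single step and has depth greater than or equal to $-1$. Let $A_H(x,t,z)$ be the generating function of clusters reducing to a horizontal step, where $x$ marks length, $t$ marks the number of marked subwords of the cluster, and $z$ marks the number of letters $H$; let $A'_H(x,t,z)$ be the analogous generating function of clusters reducing to a horizontal step and having depth $0$; define $A_D,A'_D$ and $A_U,A'_U$ in the same way for clusters reducing to a down step and to an up step, respectively. Let $F(x,t,z)=\sum_{w}x^{|w|}t^{|w|_S}z^{|w|_H}$, the sum over all Motzkin words $w$. Then $$F(x,t+1,z)=\frac{2ys}{2(1-l')ys-y's'+y's'l+y's'\sqrt{(1-l)^2-4ys}},$$ where $l=xz+A_H(x,t,z)$, $l'=xz+A'_H(x,t,z)$, $y=x+A_U(x,t,z)$, $y'=x+A'_U(x,t,z)$, $s=x+A_D(x,t,z)$, $s'=x+A'_D(x,t,z)$.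
   Context: A Motzkin word of length $n$ is a word over $\{U,D,H\}$ which, drawn with $U=(1,1)$, $D=(1,-1)$, $H=(1,0)$ from the origin, ends at $(n,0)$ and never goes below the $x$-axis (the empty word included). For a word $w$: $|w|$ is its length, $|w|_H$ its number of letters $H$, and $|w|_S$ the total number of occurrences (at distinct positions) of words of $S$ as consecutive subwords of $w$. A marked subword of $w=a_1\cdots a_n$ is a pair $(i,v)$ with $v=a_ia_{i+1}\cdots a_{i+|v|-1}\in S$. A marked word is a word together with a (possibly empty) set of its marked subwords. A cluster is a marked word (with nonempty underlying word) that is not the concatenation of two nonempty marked words, i.e. its marked subwords cover the word and the chain of marked subwords overlaps so that it cannot be cut between two consecutive letters without cutting a marked subword. A word $w$ reduces to an up step, down step, horizontal step if $|w|_U-|w|_D$ equals $1,-1,0$ respectively; a cluster reduces to a step if its underlying word does. Depth of a word reducing to a single step: draw it from the origin and let $k$ be the minimal $y$-coordinate reached; the depth is $k$ if it reduces to an up or horizontal step and $k+1$ if it reduces to a down step. *)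

(* Defs.v *)
From HB Require Import structures.
From mathcomp Require Import all_boot all_order all_algebra.
From mathcomp Require Import finmap.
From mathcomp Require Import boolp zify.
Set Implicit Arguments.
Unset Strict Implicit.
Unset Printing Implicit Defensive.
Import Order.TTheory GRing.Theory Num.Theory.
Local Open Scope ring_scope.

(* Formal power series in one variable [x].  The record keeps this Cauchy     *)
(* product apart from the pointwise product on [nat -> R].                    *)

Record fps (R : Type) := Fps { fpscoef : nat -> R }.

HB.instance Definition _ (R : Type) := gen_eqMixin (fps R).
HB.instance Definition _ (R : Type) := gen_choiceMixin (fps R).

Lemma fpsP (R : Type) (f g : fps R) : fpscoef f =1 fpscoef g <-> f = g.
Proof. by split=> [|->//]; case: f g => [f] [g] /= /funext->. Qed.

Section FpsZmod.
Variable R : zmodType.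
Implicit Types f g h : fps R.

Definition fps_zero : fps R := Fps (fun=> 0).
Definition fps_opp f := Fps (fun n => - fpscoef f n).
Definition fps_add f g := Fps (fun n => fpscoef f n + fpscoef g n).

Lemma fps_addA : associative fps_add.
Proof. by move=> f g h; apply/fpsP => n /=; rewrite addrA. Qed.
Lemma fps_addC : commutative fps_add.
Proof. by move=> f g; apply/fpsP => n /=; rewrite addrC. Qed.
Lemma fps_add0 : left_id fps_zero fps_add.
Proof. by move=> f; apply/fpsP => n /=; rewrite add0r. Qed.
Lemma fps_addN : left_inverse fps_zero fps_opp fps_add.
Proof. by move=> f; apply/fpsP => n /=; rewrite addNr. Qed.

HB.instance Definition _ :=
  GRing.isZmodule.Build (fps R) fps_addA fps_addC fps_add0 fps_addN.

Lemma coef_fps0 n : fpscoef (0 : fps R) n = 0. Proof. by []. Qed.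
Lemma coef_fpsN f n : fpscoef (- f) n = - fpscoef f n. Proof. by []. Qed.
Lemma coef_fpsD f g n : fpscoef (f + g) n = fpscoef f n + fpscoef g n.
Proof. by []. Qed.
End FpsZmod.

Section FpsRing.
Variable R : comNzRingType.
Implicit Types f g h : fps R.

Definition fps_one : fps R := Fps (fun n => (n == 0%N)%:R).
Definition fps_mul f g :=
  Fps (fun n => \sum_(i < n.+1) fpscoef f i * fpscoef g (n - i)).

Definition fps_trunc m f : {poly R} := \poly_(i < m.+1) fpscoef f i.

Lemma coef_fps_trunc m f n : (n <= m)%N -> (fps_trunc m f)`_n = fpscoef f n.
Proof. by move=> le_nm; rewrite coef_poly ltnS le_nm. Qed.

Lemma fps_mul_trunc m f g n : (n <= m)%N ->
  fpscoef (fps_mul f g) n = (fps_trunc m f * fps_trunc m g)`_n.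
Proof.
move=> le_nm; rewrite coefM /=; apply: eq_bigr => i _.
have le_in : (i <= n)%N by rewrite -ltnS.
rewrite !coef_fps_trunc //; first exact: leq_trans (leq_subr _ _) le_nm.
exact: leq_trans le_in le_nm.
Qed.

Lemma coefM_low (p p' q q' : {poly R}) n :
  (forall i, (i <= n)%N -> p`_i = p'`_i) ->
  (forall i, (i <= n)%N -> q`_i = q'`_i) -> (p * q)`_n = (p' * q')`_n.
Proof.
move=> pp' qq'; rewrite !coefM; apply: eq_bigr => i _.
by rewrite pp' -1?ltnS// qq' // leq_subr.
Qed.

Lemma fps_mulC : commutative fps_mul.
Proof. by move=> f g; apply/fpsP => n; rewrite !(fps_mul_trunc _ _ (leqnn n)) mulrC. Qed.

Lemma fps_mulA : associative fps_mul.
Proof.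
move=> f g h; apply/fpsP => n; rewrite !(fps_mul_trunc _ _ (leqnn n)).
transitivity ((fps_trunc n f * (fps_trunc n g * fps_trunc n h))`_n).
  apply: coefM_low => // i lein.
  by rewrite coef_fps_trunc // (fps_mul_trunc _ _ lein).
rewrite mulrA; apply: coefM_low => // i lein.
by rewrite coef_fps_trunc // (fps_mul_trunc _ _ lein).
Qed.

Lemma fps_mul1 : left_id fps_one fps_mul.
Proof.
move=> f; apply/fpsP => n /=; rewrite big_ord_recl /= mul1r subn0 big1 ?addr0 //.
by move=> i _; rewrite mul0r.
Qed.

Lemma fps_mulDl : left_distributive fps_mul (@fps_add R).
Proof.
move=> f g h; apply/fpsP => n /=; rewrite -big_split /=.
by apply: eq_bigr => i _; rewrite mulrDl.
Qed.

Lemma fps_one_neq0 : fps_one != 0.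
Proof. by apply/eqP => /fpsP/(_ 0%N)/eqP; rewrite /= oner_eq0. Qed.

HB.instance Definition _ := GRing.Zmodule_isComNzRing.Build (fps R)
  fps_mulA fps_mulC fps_mul1 fps_mulDl fps_one_neq0.

Lemma coef_fps1 n : fpscoef (1 : fps R) n = (n == 0%N)%:R. Proof. by []. Qed.
Lemma coef_fpsM f g n :
  fpscoef (f * g) n = \sum_(i < n.+1) fpscoef f i * fpscoef g (n - i).
Proof. by []. Qed.

Definition fps_unit : {pred fps R} := fun f => `[< exists g, g * f = 1 >].

Definition fps_inv f : fps R :=
  if pselect (exists g, g * f = 1) is left ex_g then projT1 (cid ex_g) else f.

Lemma fps_mulVx : {in fps_unit, left_inverse 1 fps_inv *%R}.
Proof.
move=> f /asboolP ex_g; rewrite /fps_inv.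
by case: pselect => // ex_g'; case: (cid ex_g').
Qed.

Lemma fps_unitPl f g : g * f = 1 -> fps_unit f.
Proof. by move=> gf; apply/asboolP; exists g. Qed.

Lemma fps_invr_out : {in [predC fps_unit], fps_inv =1 id}.
Proof.
move=> f /negP nu; rewrite /fps_inv; case: pselect => // ex_g.
by case: nu; apply/asboolP.
Qed.

HB.instance Definition _ := GRing.ComNzRing_hasMulInverse.Build (fps R)
  fps_mulVx fps_unitPl fps_invr_out.

Definition fpsC (c : R) : fps R := Fps (fun n => if n == 0%N then c else 0).

Definition fpsX : fps R := Fps (fun n => (n == 1%N)%:R).

End FpsRing.

Section FpsIdomain.
Variable R : idomainType.

Lemma fps_integral : GRing.integral_domain_axiom (fps R).
Proof.
move=> f g fg0; apply/norP => -[f0 g0].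
have least (h : fps R) : h != 0 ->
    {m | fpscoef h m != 0 & forall k, (k < m)%N -> fpscoef h k = 0}.
  move=> h0; have ex_m : exists m, fpscoef h m != 0.
    apply: contrapT => nex; move/eqP: h0; apply; apply/fpsP => n.
    by apply/eqP; apply: contrapT => hn; apply: nex; exists n; apply/negP.
  case: (ex_minnP ex_m) => m hm min_m; exists m => // k ltkm.
  by apply/eqP; apply: contraLR ltkm => /min_m; rewrite -leqNgt.
have [a fa fmin] := least _ f0; have [b gb gmin] := least _ g0.
move/fpsP/(_ (a + b)%N)/eqP: fg0; rewrite coef_fpsM.
have lea : (a < (a + b).+1)%N by rewrite ltnS leq_addr.
rewrite (bigD1 (Ordinal lea)) //= addKn big1 ?addr0; last first.
  move=> i; rewrite -val_eqE /= neq_ltn => /orP[/fmin->|lt_ai].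
    by rewrite mul0r.
  rewrite gmin ?mulr0 // ltn_subLR; first by rewrite ltn_add2r.
  by rewrite -ltnS.
by rewrite mulf_eq0 (negPf fa) (negPf gb).
Qed.

HB.instance Definition _ :=
  GRing.ComUnitRing_isIntegral.Build (fps R) fps_integral.
End FpsIdomain.

Definition fps_map (R R' : Type) (phi : R -> R') (f : fps R) : fps R' :=
  Fps (fun n => phi (fpscoef f n)).

(* Square root of a series with constant coefficient 1: the root whose own    *)
(* constant coefficient is 1, obtained by solving [r * r = f] for             *)
(* coefficient n.                                                             *)
Section FpsSqrt.
Variable R : comUnitRingType.

Fixpoint fps_sqrt_seq (f : fps R) (n : nat) : seq R :=
  if n is m.+1 then
    let s := fps_sqrt_seq f m in
    rcons s (if m is 0 then 1 else
      2%:R^-1 * (fpscoef f m - \sum_(1 <= i < m) s`_i * s`_(m - i)))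
  else [::].

Definition fps_sqrt (f : fps R) : fps R := Fps (fun n => (fps_sqrt_seq f n.+1)`_n).

Lemma size_fps_sqrt_seq f n : size (fps_sqrt_seq f n) = n.
Proof. by elim: n => //= n IHn; rewrite size_rcons IHn. Qed.

Lemma nth_fps_sqrt_seq f n i : (i < n)%N ->
  (fps_sqrt_seq f n)`_i = fpscoef (fps_sqrt f) i.
Proof.
elim: n => // n IHn; rewrite ltnS leq_eqVlt => /orP[/eqP->//|ltin].
rewrite [fps_sqrt_seq _ _]/= nth_rcons size_fps_sqrt_seq ltin.
exact: IHn.
Qed.

Lemma fps_sqrt_coef0 f : fpscoef (fps_sqrt f) 0 = 1.
Proof. by []. Qed.

Lemma fps_sqrt_coefS f n : fpscoef (fps_sqrt f) n.+1 =
  2%:R^-1 * (fpscoef f n.+1 - \sum_(1 <= i < n.+1)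
    fpscoef (fps_sqrt f) i * fpscoef (fps_sqrt f) (n.+1 - i)).
Proof.
transitivity ((rcons (fps_sqrt_seq f n.+1) (2%:R^-1 * (fpscoef f n.+1 -
    \sum_(1 <= i < n.+1)
      (fps_sqrt_seq f n.+1)`_i * (fps_sqrt_seq f n.+1)`_(n.+1 - i))))`_n.+1).
  by [].
rewrite nth_rcons size_fps_sqrt_seq ltnn eqxx; congr (_ * (_ - _)).
rewrite !big_nat; apply: eq_bigr => i /andP[i_gt0 ltin].
by rewrite !nth_fps_sqrt_seq // ltn_subrL i_gt0.
Qed.

Lemma fps_sqrt_sqr f : 2%:R \is a @GRing.unit R -> fpscoef f 0 = 1 ->
  fps_sqrt f ^+ 2 = f.
Proof.
move=> u2 f0; apply/fpsP => -[|n]; rewrite expr2 coef_fpsM.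
  by rewrite big_ord1 subn0 !fps_sqrt_coef0 mulr1 f0.
rewrite -(big_mkord xpredT (fun i =>
  fpscoef (fps_sqrt f) i * fpscoef (fps_sqrt f) (n.+1 - i))).
rewrite big_nat_recl // big_nat_recr // subn0 subnn fps_sqrt_coef0 mul1r mulr1.
rewrite addrCA -mulr2n -[_ *+ 2]mulr_natl fps_sqrt_coefS mulVKr //.
by rewrite big_add1 addrC subrK.
Qed.
End FpsSqrt.

(* Coefficient ring of the generating functions: the outer variable of        *)
(* [{poly {poly rat}}] is [t], the inner one is [z].                          *)

Notation Qtz := {poly {poly rat}}.

Lemma Qtz_unit2 : 2%:R \is a @GRing.unit Qtz.
Proof.
rewrite -polyC_natr poly_unitE coefC /= -polyC_natr size_polyC polyC_eq0.
by rewrite poly_unitE coefC size_polyC.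
Qed.

Definition tz_monom (a b : nat) : Qtz := 'X ^+ a * ('X ^+ b)%:P.

Definition zvar : fps Qtz := fpsC (tz_monom 0 1).
Definition xvar : fps Qtz := fpsX Qtz.

(* G(x, t, z) |-> G(x, t + 1, z).                                             *)
Definition shift_t (G : fps Qtz) : fps Qtz :=
  fps_map (fun p : Qtz => p \Po ('X + 1)) G.

Inductive letter := U | D | H.

Definition ord_of_letter (a : letter) : 'I_3 :=
  match a with U => inord 0 | D => inord 1 | H => inord 2 end.
Definition letter_of_ord (i : 'I_3) : letter :=
  match val i with 0%N => U | 1%N => D | _ => H end.
Lemma ord_of_letterK : cancel ord_of_letter letter_of_ord.
Proof. by case; rewrite /letter_of_ord /= inordK. Qed.
HB.instance Definition _ := Finite.copy letter (can_type ord_of_letterK).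

Notation word := (seq letter).

Definition height (w : word) : int :=
  (count_mem U w)%:Z - (count_mem D w)%:Z.

Definition motzkin (w : word) : bool :=
  (height w == 0) && all (fun i => 0 <= height (take i w)) (iota 0 (size w).+1).

(* The default value 0 is the height of the origin.                           *)
Definition min_height (w : word) : int :=
  \big[Num.min/0]_(i < (size w).+1) height (take i w).

Definition reduces_to_up (w : word) : bool := height w == 1.
Definition reduces_to_down (w : word) : bool := height w == -1.
Definition reduces_to_horizontal (w : word) : bool := height w == 0.
Definition reduces_to_step (w : word) : bool :=
  [|| reduces_to_up w, reduces_to_down w | reduces_to_horizontal w].

(* Meaningful only if [reduces_to_step w].                                    *)
Definition depth (w : word) : int :=
  if reduces_to_down w then min_height w + 1 else min_height w.

(* The marked subwords of [w]; positions are counted from 0.                  *)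
Definition occ (S : {fset word}) (w : word) : {fset nat * word} :=
  [fset p : nat * word in [seq (i, v) | i <- iota 0 (size w), v <- S]
     | take (size p.2) (drop p.1 w) == p.2]%fset.

(* The mark [(i, v)] occupies the positions i, ..., i + |v| - 1, and the cut  *)
(* before position [j] cuts it when i < j < i + |v|.                          *)
Definition cluster (S : {fset word}) (w : word) (M : {fset nat * word}) : bool :=
  [&& w != [::], (M `<=` occ S w)%fset,
      all (fun j => has (fun p : nat * word => (p.1 <= j < p.1 + size p.2)%N) M)
          (iota 0 (size w))
    & all (fun j => has (fun p : nat * word => (p.1 < j < p.1 + size p.2)%N) M)
          (iota 1 (size w).-1)].

(* The same notion in terms of concatenation of marked words: the unmarked    *)
(* one-letter words are the only indecomposable ones that are not clusters.   *)
Definition marks_cat (w1 : word) (M1 M2 : {fset nat * word}) : {fset nat * word} :=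
  (M1 `|` [fset (size w1 + p.1, p.2)%N | p in M2])%fset.

Definition decomposable (S : {fset word}) (w : word) (M : {fset nat * word}) : Prop :=
  exists w1 w2 M1 M2, [/\ w1 != [::], w2 != [::],
    (M1 `<=` occ S w1)%fset, (M2 `<=` occ S w2)%fset
    & w = w1 ++ w2 /\ M = marks_cat w1 M1 M2].

Lemma occP (S : {fset word}) (w : word) (p : nat * word) :
  reflect [/\ (p.1 < size w)%N, p.2 \in S & take (size p.2) (drop p.1 w) = p.2]
          (p \in occ S w).
Proof.
case: p => i v; rewrite !inE /=; apply: (iffP andP).
  case=> /allpairsP[[j u] /= [jw uS [-> ->]]] /eqP def_u.
  by split=> //; move: jw; rewrite mem_iota.
case=> lti vS ->; split=> //; apply/allpairsP; exists (i, v).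
by split=> //=; rewrite mem_iota.
Qed.

Lemma occ_bound (S : {fset word}) (w : word) (p : nat * word) :
  p \in occ S w -> (p.1 + size p.2 <= size w)%N.
Proof.
case/occP=> lti _ /(congr1 size); rewrite size_take size_drop; case: ifP; lia.
Qed.

Lemma clusterP (S : {fset word}) (w : word) (M : {fset nat * word}) :
  [::] \notin S ->
  cluster S w M <->
  [/\ w != [::], (M `<=` occ S w)%fset, M != fset0 & ~ decomposable S w M].
Proof.
move=> S0; split.
  case/and4P=> w0 MS /allP cov /allP cut; split=> //.
    have /cov/hasP[p pM _] : 0%N \in iota 0 (size w).
      by rewrite mem_iota; case: (w) w0.
    by apply/fset0Pn; exists p.
  case=> w1 [w2 [M1 [M2 [w10 w20 /fsubsetP s1 /fsubsetP s2 [defw defM]]]]].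
  have /cut/hasP[p] : size w1 \in iota 1 (size w).-1.
    rewrite mem_iota defw size_cat; case: (w1) w10 (w2) w20 => // ? ? _ [|? ?] //= _.
    by lia.
  rewrite defM => /fsetUP[/s1/occ_bound le|/imfsetP[q _ ->] /=] /andP[].
    by move=> _ /leq_trans/(_ le); rewrite ltnn.
  by rewrite ltnNge leq_addr.
case=> w0 MS M0 ndec; have /fsubsetP sM := MS.
have cut j : (0 < j < size w)%N ->
    has (fun p : nat * word => (p.1 < j < p.1 + size p.2)%N) M.
  move=> jw; apply: contrapT => /negP/hasPn ncut; apply: ndec.
  exists (take j w), (drop j w), [fset p in M | (p.1 + size p.2 <= j)%N]%fset,
    [fset ((p.1 - j)%N, p.2) | p in M & (j <= p.1)%N]%fset.
  have szt : size (take j w) = j by rewrite size_take; case: ifP; lia.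
  split; last first.
  - split; first by rewrite cat_take_drop.
    apply/fsetP => p; apply/idP/fsetUP => [pM|[]].
    + have := ncut _ pM; case: (leqP (p.1 + size p.2) j) => [le _|lt nlt].
        by left; rewrite !inE pM le.
      right; apply/imfsetP; exists ((p.1 - j)%N, p.2).
        by apply/imfsetP; exists p => //; rewrite !inE pM /=; lia.
      by rewrite szt /= subnKC; [case: (p)|lia].
    + by rewrite !inE => /andP[].
    + case/imfsetP=> q /imfsetP[r]; rewrite !inE => /andP[rM le] -> ->.
      by rewrite szt /= subnKC //; case: (r) rM.
  - apply/fsubsetP => p /imfsetP[r rP ->]; rewrite !inE in rP.
    case/andP: rP => rM le.
    have /occP[lt vS def_v] := sM _ rM; apply/occP; split => //=.
      by rewrite size_drop; lia.
    by rewrite drop_drop subnK.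
  - apply/fsubsetP => p pP; rewrite !inE in pP; case/andP: pP => pM le.
    have /occP[lt vS def_v] := sM _ pM.
    have p20 : (0 < size p.2)%N by rewrite lt0n size_eq0; apply: contraNneq S0 => <-.
    have ltj : (p.1 < j)%N by apply: leq_trans le; rewrite -addn1 leq_add2l.
    apply/occP; split => //; first by rewrite szt.
    rewrite -[RHS]def_v -[in RHS](cat_take_drop j w) drop_cat szt.
    by rewrite ltj takel_cat // size_drop szt leq_subRL // ltnW.
  - by rewrite -size_eq0 size_drop -lt0n subn_gt0; case/andP: jw.
  - by rewrite -size_eq0 szt -lt0n; case/andP: jw.
apply/and4P; split=> //; last first.
  by apply/allP => j; rewrite mem_iota => ?; apply: cut; lia.
apply/allP => j; rewrite mem_iota add0n => /andP[_ ltj].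
have w_gt0 : (0 < size w)%N by lia.
have [j_gt0|j0] := ltnP 0 j.
  have /cut/hasP[p pM pj] : (0 < j < size w)%N by lia.
  by apply/hasP; exists p => //; lia.
have [w_gt1|w_le1] := ltnP 1 (size w).
  have /cut/hasP[p pM pj] : (0 < 1 < size w)%N by lia.
  by apply/hasP; exists p => //; lia.
have [p pM] := fset0Pn _ M0; have /occP[lt vS _] := sM _ pM.
have p20 : (0 < size p.2)%N by rewrite lt0n size_eq0; apply: contraNneq S0 => <-.
apply/hasP; exists p => //.
have -> : p.1 = 0%N by apply/eqP; rewrite -leqn0 -ltnS (leq_trans lt).
by move: j0; rewrite leqn0 => /eqP->.
Qed.

Definition cluster_gf (S : {fset word}) (P : pred word) : fps Qtz :=
  Fps (fun n => \sum_(w : n.-tuple letter | P w)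
    \sum_(M <- fpowerset (occ S w) | cluster S w M)
      tz_monom #|` M| (count_mem H w)).

(* Hence the radicand (1 - l)^2 - 4 y s has constant coefficient 1 and        *)
(* [fps_sqrt_sqr] applies to it.                                              *)
Lemma cluster_gf_coef0 (S : {fset word}) (P : pred word) :
  fpscoef (cluster_gf S P) 0 = 0.
Proof.
by rewrite /= big1 // => w _; rewrite big1 // => M; rewrite tuple0.
Qed.

Definition A_H S := cluster_gf S reduces_to_horizontal.
Definition A_D S := cluster_gf S reduces_to_down.
Definition A_U S := cluster_gf S reduces_to_up.
Definition A'_H S :=
  cluster_gf S (fun w => reduces_to_horizontal w && (depth w == 0)).
Definition A'_D S :=
  cluster_gf S (fun w => reduces_to_down w && (depth w == 0)).
Definition A'_U S :=
  cluster_gf S (fun w => reduces_to_up w && (depth w == 0)).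

Definition motzkin_gf (S : {fset word}) : fps Qtz :=
  Fps (fun n => \sum_(w : n.-tuple letter | motzkin w)
    tz_monom #|` occ S w| (count_mem H w)).

(* Main.v *)
Require Import Defs.
From mathcomp Require Import all_boot all_order all_algebra.
From mathcomp Require Import finmap.
From mathcomp Require Import zify ring.
Set Implicit Arguments.
Unset Strict Implicit.
Unset Printing Implicit Defensive.
Import Order.TTheory GRing.Theory Num.Theory.
Local Open Scope ring_scope.

(* Replacing t by t + 1 turns F into the generating function of marked Motzkin
   words.  Cutting a marked word at the first place where no mark is cut splits
   off a single letter or a cluster.  Each such block moves the path by at most
   one level, and by the depth hypothesis it always fits above the axis unless
   its lower endpoint is at level 0, where it fits exactly if its depth is 0.
   Hence the series N_h of marked paths from level h to level 0 satisfy
     N_0 = 1 + l' N_0 + y' N_1,   N_1 = s' N_0 + l N_1 + y N_2,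
     N_h = s N_(h-1) + l N_h + y N_(h+1)   for h > 1.
   If C = 1 + l C + y s C^2, then N_h = C^h s^(h-1) s' N_0 for h > 0 is the only
   solution, so that N_0 = 1 / (1 - l' - y' s' C), and 2 y s C is obtained from
   the quadratic equation. *)

(** * Power series equations: uniqueness, existence, square root *)

(** Since [l], [y] and [s] have no constant term, coefficient n of each [d h] involves only
    coefficients below n of its neighbours. Strong induction on n, for all levels at once, kills
    them all. This gives uniqueness for the infinite system. *)
Lemma fps_tridiagonal_eq0 (R : comNzRingType) (l y s : fps R) (d : nat -> fps R) :
  fpscoef l 0 = 0 -> fpscoef y 0 = 0 -> fpscoef s 0 = 0 ->
  d 0%N = l * d 0%N + y * d 1%N ->
  (forall h, d h.+1 = s * d h + l * d h.+1 + y * d h.+2) ->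
  forall h, d h = 0.
Proof.
move=> l0 y0 s0 d0 dS.
have low (f g : fps R) n : fpscoef f 0 = 0 ->
    (forall m, (m < n)%N -> fpscoef g m = 0) -> fpscoef (f * g) n = 0.
  move=> f0 gn; rewrite coef_fpsM big1 // => -[[|i] lti] _ /=.
    by rewrite f0 mul0r.
  by rewrite gn ?mulr0 //; lia.
suff dn n h : fpscoef (d h) n = 0 by move=> h; apply/fpsP => n; rewrite dn.
elim/ltn_ind: n h => n IHn [|h].
  by rewrite d0 coef_fpsD !low ?addr0 // => m /IHn.
by rewrite dS !coef_fpsD !low ?addr0 // => m /IHn.
Qed.

(** The right-hand side is an x-adic contraction: agreement below degree n becomes agreement below
    degree n + 1. Its iterates from 0 therefore stabilise coefficientwise. *)
Lemma fps_quadratic_fixpoint (R : comNzRingType) (l p : fps R) :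
  fpscoef l 0 = 0 -> fpscoef p 0 = 0 ->
  exists C : fps R, C = 1 + l * C + p * C ^+ 2.
Proof.
move=> l0 p0; pose Phi (C : fps R) := 1 + l * C + p * C ^+ 2.
pose eqn n (f g : fps R) := forall m, (m < n)%N -> fpscoef f m = fpscoef g m.
have eqM n (f f' g g' : fps R) : eqn n f f' -> eqn n g g' -> eqn n (f * g) (f' * g').
  move=> ff' gg' m ltm; rewrite !coef_fpsM; apply: eq_bigr => -[i lti] _ /=.
  by rewrite ff' ?gg' //; lia.
have eqS n (f g g' : fps R) : fpscoef f 0 = 0 -> eqn n g g' -> eqn n.+1 (f * g) (f * g').
  move=> f0 gg' m ltm; rewrite !coef_fpsM; apply: eq_bigr => -[[|i] lti] _ /=.
    by rewrite f0 !mul0r.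
  by rewrite gg' //; lia.
have eqPhi n f g : eqn n f g -> eqn n.+1 (Phi f) (Phi g).
  move=> fg m ltm; rewrite /Phi !coef_fpsD (eqS n l f g) // (eqS n p _ (g ^+ 2)) //.
  by rewrite !expr2; apply: eqM.
have step k n : (n <= k)%N -> eqn n (iter n Phi 0) (iter k Phi 0).
  elim: n k => [|n IHn] [|k] //; rewrite ltnS => lenk /=.
  by apply: eqPhi; apply: IHn.
(* Coefficient n no longer changes from iterate n + 1 on. *)
pose C := Fps (fun n => fpscoef (iter n.+1 Phi 0) n).
have eqC n : eqn n C (iter n Phi 0) by move=> m ltm; apply: step.
exists C; apply/fpsP => n.
rewrite -/(Phi C); transitivity (fpscoef (Phi (iter n Phi 0)) n) => //.
by apply: (eqPhi n) => // m ltm; rewrite (eqC n).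
Qed.

(** Completing the square shows that both sides of the difference 2pC - (1 - l) = ±r have equal
    squares. The integral domain leaves two signs, and the constant coefficients decide between
    them. *)
Lemma quadratic_fps_sqrt (R : idomainType) (l p C : fps R) :
  2%:R \is a @GRing.unit R -> fpscoef l 0 = 0 -> fpscoef p 0 = 0 ->
  C = 1 + l * C + p * C ^+ 2 ->
  2%:R * p * C = 1 - l - fps_sqrt ((1 - l) ^+ 2 - 4%:R * p).
Proof.
move=> u2 l0 p0 defC; set r := fps_sqrt _.
have low (f g : fps R) : fpscoef (f * g) 0 = fpscoef f 0 * fpscoef g 0.
  by rewrite coef_fpsM big_ord1.
have sqr : r ^+ 2 = (1 - l) ^+ 2 - 4%:R * p.
  apply: fps_sqrt_sqr => //; rewrite coef_fpsD coef_fpsN expr2 !low p0 mulr0.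
  by rewrite coef_fpsD coef_fpsN l0 coef_fps1 /= !subr0 mulr1.
have : (2%:R * p * C - (1 - l) - r) * (2%:R * p * C - (1 - l) + r) = 0.
  transitivity ((2%:R * p * C - (1 - l)) ^+ 2 - r ^+ 2); first by ring.
  have e : p * C ^+ 2 = C - 1 - l * C by rewrite {2}defC; ring.
  transitivity (4%:R * p * (p * C ^+ 2) - 4%:R * p * (1 - l) * C
                + ((1 - l) ^+ 2 - r ^+ 2)); first by ring.
  by rewrite e sqr; ring.
move/eqP; rewrite mulf_eq0 => /orP[|/eqP e]; last first.
  by apply/eqP; rewrite -subr_eq0 -e; apply/eqP; ring.
(* For the wrong sign the constant coefficient would be -1 - 1 = -2, which is nonzero because 2 is a
   unit. *)
move/eqP/fpsP/(_ 0%N)/eqP; rewrite !(coef_fpsD, coef_fpsN) !low p0 l0.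
rewrite mulr0 mul0r fps_sqrt_coef0 coef_fps1 /= subr0 sub0r.
by rewrite -opprD oppr_eq0 -[_ + _](mulr2n 1) => /eqP e; move: u2; rewrite e unitr0.
Qed.

(** * Sums over words and their generating functions *)

Section WordSums.
Variable T : finType.

(** Recursion on the letters lets a sum over words be split into prefix and suffix without casts
    between tuple types. *)
Fixpoint wsum (R : nmodType) n (f : seq T -> R) : R :=
  if n is m.+1 then \sum_a wsum m (fun w => f (a :: w)) else f [::].

Lemma big_tupleS (R : nmodType) n (f : seq T -> R) :
  \sum_(w : n.+1.-tuple T) f w = \sum_a \sum_(w : n.-tuple T) f (a :: w).
Proof.
rewrite pair_big /= (reindex (fun p : T * n.-tuple T => [tuple of p.1 :: p.2])) //=.
exists (fun w : n.+1.-tuple T => (thead w, [tuple of behead w])) => [[a w]|w] _ /=.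
  by congr pair; apply/val_inj.
by rewrite -tuple_eta.
Qed.

Lemma big_tuple_wsum (R : nmodType) n (f : seq T -> R) :
  \sum_(w : n.-tuple T) f w = wsum n f.
Proof.
elim: n f => [|n IHn] f /=.
  rewrite (big_pred1 [tuple]) // => w; apply/esym/eqP.
  exact: tuple0.
by rewrite big_tupleS; apply: eq_bigr => a _; exact: (IHn (fun w => f (a :: w))).
Qed.

Lemma eq_wsum (R : nmodType) n (f g : seq T -> R) :
  (forall w, size w = n -> f w = g w) -> wsum n f = wsum n g.
Proof.
elim: n f g => [|n IHn] f g fg /=; first exact: fg.
by apply: eq_bigr => a _; apply: IHn => w szw; apply: fg; rewrite /= szw.
Qed.

Lemma wsum_cat (R : nmodType) m n (f : seq T -> R) :
  wsum (m + n) f = wsum m (fun u => wsum n (fun v => f (u ++ v))).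
Proof. by elim: m f => //= m IHm f; apply: eq_bigr => a _; rewrite IHm. Qed.

Lemma wsumD (R : nmodType) n (f g : seq T -> R) :
  wsum n (fun w => f w + g w) = wsum n f + wsum n g.
Proof. by rewrite -!big_tuple_wsum big_split. Qed.

Lemma wsum_sum (R : nmodType) n (I : Type) (r : seq I) (f : I -> seq T -> R) :
  wsum n (fun w => \sum_(i <- r) f i w) = \sum_(i <- r) wsum n (f i).
Proof.
rewrite -big_tuple_wsum exchange_big /=; apply: eq_bigr => i _.
exact: big_tuple_wsum.
Qed.

Lemma wsum_mul (R : comNzRingType) m n (f g : seq T -> R) :
  wsum m (fun u => wsum n (fun v => f u * g v)) = wsum m f * wsum n g.
Proof.
rewrite -!big_tuple_wsum mulr_suml; apply: eq_bigr => u _.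
by rewrite -!big_tuple_wsum mulr_sumr.
Qed.

Definition word_gf (R : nmodType) (f : seq T -> R) : fps R :=
  Fps (fun n => wsum n f).

Lemma eq_word_gf (R : nmodType) (f g : seq T -> R) : f =1 g -> word_gf f = word_gf g.
Proof. by move=> fg; apply/fpsP => n; apply: eq_wsum => w _. Qed.

Lemma word_gfD (R : zmodType) (f g : seq T -> R) :
  word_gf (fun w => f w + g w) = word_gf f + word_gf g.
Proof. by apply/fpsP => n; apply: wsumD. Qed.

Lemma word_gf_nil (R : comNzRingType) :
  word_gf (fun w => (w == [::])%:R : R) = 1.
Proof.
apply/fpsP => -[|n] //=; rewrite big1 // => a _.
by rewrite -big_tuple_wsum big1.
Qed.

Definition wconv (R : comNzRingType) (f g : seq T -> R) (w : seq T) : R :=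
  \sum_(0 <= i < (size w).+1) f (take i w) * g (drop i w).

(** A word of length n with a cut at place i is the same as a pair of words of lengths i and n - i,
    which is the Cauchy product. *)
Lemma word_gf_conv (R : comNzRingType) (f g : seq T -> R) :
  word_gf (wconv f g) = word_gf f * word_gf g.
Proof.
apply/fpsP => n; rewrite coef_fpsM /=.
transitivity (wsum n (fun w => \sum_(0 <= i < n.+1) f (take i w) * g (drop i w))).
  by apply: eq_wsum => w szw; rewrite /wconv szw.
rewrite wsum_sum big_mkord; apply: eq_bigr => -[i /= lti] _.
rewrite -{1}(@subnKC i n) // wsum_cat -wsum_mul.
apply: eq_wsum => u szu; apply: eq_wsum => v _.
by rewrite -szu take_size_cat ?drop_size_cat.
Qed.

End WordSums.

(** * Cutting a marked word after its first block *)

Lemma find_eqE (T : Type) (x0 : T) (a : pred T) (s : seq T) j : (j < size s)%N ->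
  (find a s == j) = all (predC a) (take j s) && a (nth x0 s j).
Proof.
elim: s j => [|x s IHs] [|j] //=; first by case: (a x).
by rewrite ltnS -andbA => /IHs <-; case: (a x).
Qed.

Section Marks.
Variable S : {fset word}.
Implicit Types (u v w : word) (M : {fset nat * word}).

Definition cuts M j := has (fun p : nat * word => (p.1 < j < p.1 + size p.2)%N) M.

(** This is the last clause of [cluster] alone. Without the covering clause it also admits unmarked
    single letters, and the empty word. *)
Definition inner_cut w M := all (cuts M) (iota 1 (size w).-1).

Lemma marks_cat_occ u v M1 M2 :
  (M1 `<=` occ S u)%fset -> (M2 `<=` occ S v)%fset ->
  (marks_cat u M1 M2 `<=` occ S (u ++ v))%fset.
Proof.
move=> /fsubsetP s1 /fsubsetP s2; apply/fsubsetP => p /fsetUP[/s1 pu|].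
  have /occP[lt pS defp] := pu; apply/occP; split=> //.
    by rewrite size_cat ltn_addr.
  by rewrite drop_cat lt takel_cat // size_drop; have := occ_bound pu; lia.
case/imfsetP=> q /s2/occP[lt qS defq] -> /=; apply/occP; split=> //=.
  by rewrite size_cat ltn_add2l.
by rewrite drop_cat ltnNge leq_addr /= addKn.
Qed.

Lemma marks_cat_left u M1 M2 : (M1 `<=` occ S u)%fset ->
  [fset p in marks_cat u M1 M2 | (p.1 < size u)%N]%fset = M1.
Proof.
move=> /fsubsetP s1; apply/fsetP => p; rewrite !inE /=.
apply/andP/idP => [[/orP[//|/imfsetP[q _ ->]] /=]|pM]; first by lia.
by rewrite pM; have /occP[] := s1 _ pM.
Qed.

Lemma marks_cat_right u M1 M2 : (M1 `<=` occ S u)%fset ->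
  [fset ((p.1 - size u)%N, p.2) | p in marks_cat u M1 M2 & (size u <= p.1)%N]%fset
  = M2.
Proof.
move=> /fsubsetP s1; apply/fsetP => p; apply/imfsetP/idP => [[q]|pM].
  rewrite !inE /= => /andP[/orP[/s1/occP[lt _ _]|/imfsetP[r rM ->]] le ->].
    by lia.
  by rewrite /= addKn; case: (r) rM.
exists ((size u + p.1)%N, p.2); last by rewrite /= addKn; case: (p).
rewrite !inE /= leq_addr andbT; apply/orP; right.
by apply/imfsetP; exists p.
Qed.

(** A mark that is not cut by the seam lies wholly on one side of it, and its starting position
    tells which. *)
Lemma marks_split u v M : (M `<=` occ S (u ++ v))%fset -> ~~ cuts M (size u) ->
  exists M1 M2, [/\ (M1 `<=` occ S u)%fset, (M2 `<=` occ S v)%fset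
                  & M = marks_cat u M1 M2].
Proof.
move=> /fsubsetP sM /hasPn ncut.
exists [fset p in M | (p.1 < size u)%N]%fset,
  [fset ((p.1 - size u)%N, p.2) | p in M & (size u <= p.1)%N]%fset; split.
- apply/fsubsetP => p pP; rewrite !inE /= in pP; case/andP: pP => pM lt.
  have /occP[_ pS defp] := sM _ pM; have := ncut _ pM; rewrite lt /= -leqNgt => le.
  apply/occP; split=> //; move: defp; rewrite drop_cat lt takel_cat //.
  by rewrite size_drop; lia.
- apply/fsubsetP => q /imfsetP[p pP ->]; rewrite !inE /= in pP; case/andP: pP => pM le.
  have /occP[lt pS defp] := sM _ pM; apply/occP; split=> //=.
    by move: lt; rewrite size_cat; lia.
  by move: defp; rewrite drop_cat ltnNge le.
apply/fsetP => p; rewrite !inE /=; apply/idP/orP => [pM|[/andP[]//|]].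
  have [lt|le] := ltnP p.1 (size u); first by left; rewrite pM.
  right; apply/imfsetP; exists ((p.1 - size u)%N, p.2).
    by apply/imfsetP; exists p; rewrite // !inE /= pM.
  by rewrite /= subnKC //; case: (p).
case/imfsetP=> q /imfsetP[r]; rewrite !inE /= => /andP[rM le] -> ->.
by rewrite /= subnKC //; case: (r) rM.
Qed.

Lemma cuts_marks_cat u M1 M2 j : (j <= size u)%N ->
  cuts (marks_cat u M1 M2) j = cuts M1 j.
Proof.
move=> lej; apply/hasP/hasP => -[p pM cutp]; last first.
  by exists p => //; rewrite !inE pM.
move: pM cutp; rewrite !inE => /orP[pM|/imfsetP[q _ ->] /=]; first by exists p.
by lia.
Qed.

Lemma cuts_size u M : (M `<=` occ S u)%fset -> ~~ cuts M (size u).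
Proof.
by move=> /fsubsetP sM; apply/hasPn => p /sM/occ_bound le; lia.
Qed.

Lemma card_marks_cat u M1 M2 : (M1 `<=` occ S u)%fset ->
  #|` marks_cat u M1 M2| = (#|` M1| + #|` M2|)%N.
Proof.
move=> /fsubsetP s1; have /leqifP := leq_card_fsetU M1
  [fset ((size u + p.1)%N, p.2) | p in M2]%fset.
rewrite ifT => [/eqP|]; last first.
  apply/fdisjointP => p /s1/occP[lt _ _]; apply/imfsetP => -[q _ defp].
  by rewrite defp /= in lt; lia.
rewrite /marks_cat => ->; congr (_ + _)%N.
by rewrite card_imfset //= => -[i p] [j q] /= [/addnI-> ->].
Qed.

(** Gluing never produces a mark across the seam, and whether an inner place of [u] is cut depends
    on the left marks only. Both mark sets are recovered from the glued one by comparing starting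
    positions with [size u]. *)
Lemma perm_first_cut u v :
  perm_eq [seq M <- fpowerset (occ S (u ++ v)) | inner_cut u M && ~~ cuts M (size u)]
    [seq marks_cat u M1 M2 |
       M1 <- [seq M1 <- fpowerset (occ S u) | inner_cut u M1],
       M2 <- fpowerset (occ S v)].
Proof.
have inner M1 M2 : inner_cut u (marks_cat u M1 M2) = inner_cut u M1.
  apply: eq_in_all => j; rewrite mem_iota => ltj.
  by apply: cuts_marks_cat; lia.
apply: uniq_perm.
- by rewrite filter_uniq // fset_uniq.
- apply: allpairs_uniq; [by rewrite filter_uniq // fset_uniq|exact: fset_uniq|].
  move=> [M1 M2] [M1' M2'] /allpairsP[[X Y] /= [XM YM [-> ->]]].
  move=> /allpairsP[[X' Y'] /= [XM' YM' [-> ->]]] eqM.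
  move: XM XM'; rewrite !mem_filter !fpowersetE => /andP[_ sX] /andP[_ sX'].
  have := marks_cat_left Y sX; have := marks_cat_right Y sX.
  by rewrite eqM marks_cat_left // marks_cat_right // => -> ->.
move=> M; rewrite mem_filter fpowersetE; apply/andP/allpairsP.
  case=> /andP[inM ncut] sM; have [M1 [M2 [s1 s2 defM]]] := marks_split sM ncut.
  exists (M1, M2); rewrite /= mem_filter !fpowersetE s1 s2 defM; split=> //.
  by rewrite -(inner M1 M2) -defM inM.
case=> -[M1 M2] /=; rewrite mem_filter !fpowersetE => -[/andP[in1 s1] s2 ->].
by rewrite inner in1 cuts_marks_cat // cuts_size // marks_cat_occ.
Qed.

Definition mark_weight w M : Qtz := tz_monom #|` M| (count_mem H w).

Lemma mark_weight_cat u v M1 M2 : (M1 `<=` occ S u)%fset ->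
  mark_weight (u ++ v) (marks_cat u M1 M2) = mark_weight u M1 * mark_weight v M2.
Proof.
move=> s1; rewrite /mark_weight /tz_monom card_marks_cat // count_cat !exprD rmorphM /=.
by rewrite mulrACA.
Qed.

Definition marked_weight w : Qtz := \sum_(M <- fpowerset (occ S w)) mark_weight w M.

(** The empty word satisfies [inner_cut] vacuously and must be excluded, so that the first block is
    always nonempty and the factorisation is unique. *)
Definition block_weight w : Qtz :=
  if w == [::] then 0
  else \sum_(M <- fpowerset (occ S w) | inner_cut w M) mark_weight w M.

Lemma occ_nil : occ S [::] = fset0.
Proof. by apply/fsetP => p; rewrite in_fset0; apply/negP => /occP[]. Qed.

Lemma marked_weight_nil : marked_weight [::] = 1.
Proof.
rewrite /marked_weight occ_nil fpowerset0 big_seq_fset1.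
by rewrite /mark_weight /tz_monom cardfs0 !expr0 mulr1.
Qed.

Lemma first_block_sum u v : u != [::] ->
  \sum_(M <- fpowerset (occ S (u ++ v)) | inner_cut u M && ~~ cuts M (size u))
     mark_weight (u ++ v) M = block_weight u * marked_weight v.
Proof.
move=> u0; rewrite -big_filter (perm_big _ (perm_first_cut u v)) big_allpairs_dep.
rewrite /block_weight (negPf u0) mulr_suml big_filter [LHS]big_seq_cond [RHS]big_seq_cond.
apply: eq_bigr => M1 /andP[]; rewrite fpowersetE => s1 _.
by rewrite mulr_sumr; apply: eq_bigr => M2 _; apply: mark_weight_cat.
Qed.

(** The mark sets of a nonempty word are sorted by the first place where no mark is cut. Such a
    place exists because no mark extends past the end of the word. *)
Lemma marked_weight_conv w :
  marked_weight w = (w == [::])%:R + wconv block_weight marked_weight w.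
Proof.
case: w => [|a w']; first by rewrite /wconv big_nat1 mul0r addr0 marked_weight_nil.
set w := a :: w'; set n := size w'.
rewrite add0r /wconv big_nat_recl // mul0r add0r big_mkord.
(* The list of places starts at 1, so index j stands for place j + 1; it includes the end of the
   word. *)
pose first M := find (fun j => ~~ cuts M j) (iota 1 (size w)).
have first_lt M : M \in fpowerset (occ S w) -> (first M < n.+1)%N.
  rewrite fpowersetE => /cuts_size ncut.
  have -> : n.+1 = size (iota 1 (size w)) by rewrite size_iota.
  by rewrite -has_find; apply/hasP; exists (size w); rewrite ?mem_iota //=; lia.
rewrite [LHS]/marked_weight big_seq (partition_big (fun M => inord (first M) : 'I_n.+1) xpredT) //=.
apply: eq_bigr => -[j ltj] _ /=.
have szj : size (take j.+1 w) = j.+1 by rewrite size_takel.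
rewrite -[a :: take j w']/(take j.+1 w) -[drop j w']/(drop j.+1 w).
rewrite -first_block_sum // cat_take_drop [RHS]big_seq_cond.
apply: eq_bigl => M; apply: andb_id2l => MS.
rewrite -val_eqE /= inordK ?first_lt // /inner_cut szj /first (find_eqE 0).
  rewrite take_iota (minn_idPl (ltnW ltj)) nth_iota // add1n size_takel //.
  by congr (_ && _); apply: eq_all => i /=; rewrite negbK.
by rewrite size_iota.
Qed.

(** For words of length at least 2, cutting all inner places already forces the marks to cover every
    letter. A marked single letter is a cluster because it has no two nonempty factors. *)
Lemma inner_cutE w M : [::] \notin S -> w != [::] -> (M `<=` occ S w)%fset ->
  inner_cut w M = cluster S w M || (size w == 1%N) && (M == fset0).
Proof.
move=> S0 w0 sM; have [->|M0] := eqVneq M fset0.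
  rewrite /cluster w0 fsub0set /=; case: w w0 {sM} => [|a [|b w]] //= _.
have [w1|w1] := eqVneq (size w) 1%N.
  rewrite orbF; transitivity true; first by rewrite /inner_cut w1.
  apply/esym/(clusterP _ _ S0); split=> // -[u [v [_ [_ [u0 v0 _ _ [defw _]]]]]].
  by move: w1; rewrite defw size_cat; case: (u) u0 => // ? ?; case: (v) v0 => //= *; lia.
rewrite orbF /cluster w0 sM /= -/(inner_cut w M) andb_idl // => /allP inM.
apply/allP => j; rewrite mem_iota => ltj.
(* A mark cutting place j covers letter j; letter 0 is covered by a mark cutting place 1. *)
have /inM/hasP[p pM cutp] : maxn j 1 \in iota 1 (size w).-1 by rewrite mem_iota; lia.
by apply/hasP; exists p => //; lia.
Qed.

Definition cluster_weight w : Qtz :=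
  \sum_(M <- fpowerset (occ S w) | cluster S w M) mark_weight w M.

Definition letter_weight w : Qtz :=
  if size w == 1%N then mark_weight w fset0 else 0.

(** A block is an unmarked letter or a cluster, and never both, since a cluster carries at least one
    mark. *)
Lemma block_weightE w : [::] \notin S ->
  block_weight w = letter_weight w + cluster_weight w.
Proof.
move=> S0; rewrite /block_weight; have [->|w0] := eqVneq w [::].
  by rewrite /letter_weight /cluster_weight /= add0r big1.
rewrite big_seq_cond (bigID (cluster S w)) /= addrC; congr (_ + _); last first.
  rewrite [RHS]big_seq_cond; apply: eq_bigl => M; rewrite -andbA; apply: andb_id2l.
  by rewrite fpowersetE => sM; rewrite inner_cutE //; case: (cluster _ _ _); rewrite ?andbF.
have nc0 : ~~ cluster S w fset0.
  by apply/negP => /(clusterP _ _ S0)[_ _]; rewrite eqxx.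
transitivity (\sum_(M <- fpowerset (occ S w) | (size w == 1%N) && (M == fset0))
    mark_weight w M).
  rewrite [RHS]big_seq_cond; apply: eq_bigl => M; rewrite -andbA; apply: andb_id2l.
  rewrite fpowersetE => sM; rewrite inner_cutE //.
  by have [->|] := eqVneq M fset0; rewrite ?(negPf nc0) ?andbT // andbF orbF andbN.
rewrite /letter_weight; case: eqP => _ /=; last by rewrite big_pred0.
rewrite big_mkcond (bigD1_seq fset0) ?fset_uniq ?fpowersetE ?fsub0set //=.
by rewrite big1 ?addr0 // => M /negPf->.
Qed.

End Marks.

(** * Paths above the axis from an arbitrary starting level *)

(** As a partial map on levels, undefined once the path goes below the axis, the path condition
    composes under concatenation. *)
Fixpoint walk (h : nat) (w : word) : option nat :=
  match w with
  | [::] => Some h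
  | U :: w' => walk h.+1 w'
  | D :: w' => if h is h'.+1 then walk h' w' else None
  | H :: w' => walk h w'
  end.

Lemma walk_cat h u v : walk h (u ++ v) = obind (fun h' => walk h' v) (walk h u).
Proof. by elim: u h => [|[] u IHu] [|h] //=. Qed.

Lemma height_nil : height [::] = 0. Proof. by []. Qed.

Lemma height1 :
  (height [:: U] = 1) * (height [:: D] = -1) * (height [:: H] = 0).
Proof.
split; [split|]; rewrite /height /= ?eqxx //.
- by have /negPf-> : U != D by apply/eqP.
- by have /negPf-> : D != U by apply/eqP.
- have /negPf-> : H != U by apply/eqP.
  by have /negPf-> : H != D by apply/eqP.
Qed.

Lemma height_cons a w : height (a :: w) = height [:: a] + height w.
Proof. by rewrite /height /=; case: a => /=; lia. Qed.

Lemma min_heightP w k :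
  reflect (forall i, (i <= size w)%N -> k <= height (take i w)) (k <= min_height w).
Proof.
have h0 : height (take 0 w) = 0 by rewrite take0.
rewrite /min_height; apply: (iffP idP) => [le i lei|le].
  apply: le_trans le _; rewrite -ltnS in lei.
  exact: (bigmin_le_cond _ (j := Ordinal lei)).
(* The default value 0 of the minimum is the height of the empty prefix. *)
apply/bigmin_geP; split=> [|i _]; first by rewrite -h0 le.
by apply: le; rewrite -ltnS.
Qed.

Lemma walkE h w : walk h w =
  if 0 <= h%:Z + min_height w then Some (absz (h%:Z + height w)) else None.
Proof.
have -> : (0 <= h%:Z + min_height w) = (- h%:Z <= min_height w) by lia.
elim: w h => [|a w IHw] h.
  rewrite ifT; first by rewrite height_nil addr0.
  by apply/min_heightP => -[|i] // _; rewrite take0 height_nil; lia.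
(* The first letter only shifts the starting level, provided that the new level is not negative. *)
have step : 0 <= h%:Z + height [:: a] ->
    (- h%:Z <= min_height (a :: w)) = (- (h%:Z + height [:: a]) <= min_height w).
  move=> ha; apply/min_heightP/min_heightP => le i lei.
    by have := le i.+1 lei; rewrite /= (height_cons a (take i w)); lia.
  case: i lei => [|i] lei; first by rewrite take0 height_nil; lia.
  by have := le i lei; rewrite /= (height_cons a (take i w)); lia.
case: a step => step; rewrite [LHS]/= (height_cons _ w).
- rewrite IHw step; last by rewrite height1; lia.
  by rewrite height1 (addrA h%:Z) (_ : h.+1%:Z = h%:Z + 1) //; lia.
- case: h IHw step => [|h] IHw step.
    rewrite ifF //; apply/negP => /min_heightP/(_ 1%N isT).
    by rewrite /= take0 height1.
  rewrite IHw step; last by rewrite height1; lia.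
  by rewrite height1 (addrA h.+1%:Z) (_ : h.+1%:Z + -1 = h%:Z) //; lia.
- rewrite IHw step; last by rewrite height1; lia.
  by rewrite height1 add0r addr0.
Qed.

Lemma motzkin_walk w : motzkin w = (walk 0 w == Some 0%N).
Proof.
rewrite walkE !add0r /motzkin.
have -> : all (fun i => 0 <= height (take i w)) (iota 0 (size w).+1) = (0 <= min_height w).
  apply/allP/min_heightP => le i; first by move=> lei; apply: le; rewrite mem_iota.
  by rewrite mem_iota => lei; apply: le; lia.
case: ifP => _; rewrite ?andbT ?andbF //.
by rewrite -[RHS]/(absz (height w) == 0%N) absz_eq0.
Qed.

Lemma min_height_le w : min_height w <= 0 /\ min_height w <= height w.
Proof.
have /min_heightP le := lexx (min_height w).
by have := le 0%N isT; have := le _ (leqnn (size w)); rewrite take0 take_size.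
Qed.

(* A word of depth at least -1 can only leave the upper half-plane when its
   lower endpoint lies on the axis. *)
Lemma walk_up h w : -1 <= depth w -> reduces_to_up w ->
  (walk h w == Some h.+1) = ((0 < h)%N || (depth w == 0)).
Proof.
move=> w_depth /eqP hw; have [m0 mh] := min_height_le w; rewrite walkE.
have dw : depth w = min_height w by rewrite /depth /reduces_to_down hw.
rewrite hw in mh *; rewrite dw; rewrite dw in w_depth.
by case: ifP => le; [rewrite (_ : absz _ = h.+1) ?eqxx|rewrite -[LHS]/false]; lia.
Qed.

Lemma walk_horizontal h w : -1 <= depth w -> reduces_to_horizontal w ->
  (walk h w == Some h) = ((0 < h)%N || (depth w == 0)).
Proof.
move=> w_depth /eqP hw; have [m0 mh] := min_height_le w; rewrite walkE.
have dw : depth w = min_height w by rewrite /depth /reduces_to_down hw.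
rewrite hw in mh *; rewrite dw; rewrite dw in w_depth.
by case: ifP => le; [rewrite (_ : absz _ = h) ?eqxx|rewrite -[LHS]/false]; lia.
Qed.

(** The lower endpoint is now the final one. The added 1 in the depth measures the minimum from
    there, so the condition on [h] is the same as for the other steps. *)
Lemma walk_down h w : -1 <= depth w -> reduces_to_down w ->
  (walk h.+1 w == Some h) = ((0 < h)%N || (depth w == 0)).
Proof.
move=> w_depth /eqP hw; have [m0 mh] := min_height_le w; rewrite walkE.
have dw : depth w = min_height w + 1 by rewrite /depth /reduces_to_down hw.
rewrite hw in mh *; rewrite dw; rewrite dw in w_depth.
by case: ifP => le; [rewrite (_ : absz _ = h) ?eqxx|rewrite -[LHS]/false]; lia.
Qed.

Lemma walk_height h h' w : walk h w = Some h' -> height w = h'%:Z - h%:Z.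
Proof.
by rewrite walkE; case: ifP => // le [<-]; have [_] := min_height_le w; lia.
Qed.

(** * Sums over subsets and letters *)

(** This is the effect of replacing t by t + 1: each occurrence is either marked or not. The
    induction separates the subsets that contain the new element from those that avoid it. *)
Lemma sum_fpowerset_expr (K : choiceType) (R : comNzRingType) (x : R) (A : {fset K}) :
  \sum_(B <- fpowerset A) x ^+ #|` B| = (x + 1) ^+ #|` A|.
Proof.
elim/fset1U_rect: A => [|a A aA IHA].
  by rewrite fpowerset0 big_seq_fset1 cardfs0 !expr0.
have perm : perm_eq (fpowerset (a |` A)%fset)
    (fpowerset A ++ [seq (a |` B)%fset | B <- fpowerset A]).
  apply: uniq_perm; first exact: fset_uniq.
    rewrite cat_uniq fset_uniq map_inj_in_uniq ?fset_uniq /=.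
      rewrite andbT; apply/hasPn => _ /mapP[B _ ->]; rewrite /= fpowersetE.
      by apply: contra aA => /fsubsetP; apply; rewrite !inE eqxx.
    move=> B C; rewrite !fpowersetE => /fsubsetP sB /fsubsetP sC eqBC.
    have aB : a \notin B by apply: contra aA => /sB.
    have aC : a \notin C by apply: contra aA => /sC.
    by rewrite -(fsetU1K aB) eqBC fsetU1K.
  move=> B; rewrite mem_cat !fpowersetE; apply/idP/orP => [sB|[sB|]].
  - have [aB|aB] := boolP (a \in B); last first.
      left; apply/fsubsetP => b bB; move/fsubsetP/(_ b bB): sB; rewrite !inE.
      by case: eqP => [eqb|//]; move: aB; rewrite -eqb bB.
    right; apply/mapP; exists (B `\ a)%fset; last by rewrite fsetD1K.
    by rewrite fpowersetE fsubDset.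
  - exact: fsubset_trans sB (fsubsetU1 _ _).
  - by case/mapP=> C; rewrite fpowersetE => sC ->; rewrite fsetUS.
rewrite (perm_big _ perm) big_cat big_map /= IHA cardfsU1 aA add1n exprS mulrDl mul1r.
rewrite addrC; congr (_ + _); rewrite -IHA mulr_sumr !big_seq; apply: eq_bigr => B.
rewrite fpowersetE => /fsubsetP sB; rewrite cardfsU1 -exprS.
by rewrite (contra (sB a)) // add1n.
Qed.

Lemma big_letter (R : nmodType) (F : letter -> R) : \sum_a F a = F U + F D + F H.
Proof.
have DU : D != U by apply/eqP.
have HUD : (H != U) && (H != D) by apply/andP; split; apply/eqP.
rewrite (bigD1 U) //= (bigD1 D) //= (bigD1 H) //= big_pred0 ?addr0 ?addrA //.
by case; rewrite eqxx ?andbF.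
Qed.

Lemma coef_fpsCM (R : comNzRingType) (c : R) (f : fps R) n :
  fpscoef (fpsC c * f) n = c * fpscoef f n.
Proof.
rewrite coef_fpsM big_ord_recl /= subn0 big1 ?addr0 // => i _.
by rewrite mul0r.
Qed.

(** * The linear system for marked paths *)

Section PathSystem.
Variable S : {fset word}.
Hypothesis S_nonempty_words : [::] \notin S.
Hypothesis S_clusters : forall (w : word) (M : {fset nat * word}),
  cluster S w M -> reduces_to_step w /\ -1 <= depth w.

Lemma letter_step a : reduces_to_step [:: a] /\ -1 <= depth [:: a].
Proof.
have m1 : -1 <= min_height [:: a].
  apply/min_heightP => -[|[|i]] // _; rewrite /= ?height_nil //.
  by case: a; rewrite height1.
split; last by rewrite /depth; case: ifP; lia.
rewrite /reduces_to_step /reduces_to_up /reduces_to_down /reduces_to_horizontal.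
by case: a {m1}; rewrite height1.
Qed.

(** A nonzero weight needs an actual cluster, so the hypothesis on clusters becomes usable for
    weights. *)
Lemma cluster_weight_step w :
  cluster_weight S w != 0 -> reduces_to_step w /\ -1 <= depth w.
Proof.
move=> nz; have /hasP[M _ /S_clusters//] : has (cluster S w) (fpowerset (occ S w)).
apply: contraNT nz => /hasPn nc; rewrite /cluster_weight big_seq_cond big_pred0 // => M.
by apply/negP => /andP[/nc/negP].
Qed.

Lemma block_weight_step w :
  block_weight S w != 0 -> reduces_to_step w /\ -1 <= depth w.
Proof.
rewrite block_weightE // /letter_weight; have [|_] := eqVneq (size w) 1%N.
  by case: w => [|a []] // _ _; apply: letter_step.
by rewrite add0r; apply: cluster_weight_step.
Qed.

Lemma letter_gf (P : pred word) :
  word_gf (fun w => (P w)%:R * letter_weight w) =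
  xvar *+ P [:: U] + xvar *+ P [:: D] + (xvar * zvar) *+ P [:: H].
Proof.
have coefMn (f : fps Qtz) (b : bool) n : fpscoef (f *+ b) n = b%:R * fpscoef f n.
  by case: b; rewrite ?mul1r ?mul0r.
have w1 a : letter_weight [:: a] = tz_monom 0 (a == H).
  by rewrite /letter_weight /mark_weight cardfs0 /= addn0.
have m00 : tz_monom 0 0 = 1 by rewrite /tz_monom !expr0 mulr1.
apply/fpsP => n; rewrite !coef_fpsD !coefMn [xvar * zvar]mulrC coef_fpsCM /=.
case: n => [|[|n]] /=; last 1 first.
- rewrite !mulr0 !addr0 big1 // => a _; rewrite big1 // => b _.
  by rewrite -big_tuple_wsum big1 // => w _; rewrite /letter_weight /= mulr0.
- by rewrite /letter_weight /= !mulr0 !addr0.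
rewrite big_letter !w1 !mulr1.
have /negPf-> : U != H by apply/eqP.
have /negPf-> : D != H by apply/eqP.
by rewrite eqxx m00 !mulr1.
Qed.

Lemma cluster_gfE (P : pred word) :
  cluster_gf S P = word_gf (fun w => (P w)%:R * cluster_weight S w).
Proof.
apply/fpsP => n; rewrite /= -big_tuple_wsum big_mkcond; apply: eq_bigr => w _.
by case: (P w); rewrite ?mul1r ?mul0r.
Qed.

(** Words violating the step or depth condition have cluster weight 0, so the path condition may be
    exchanged for one on reduction and depth, which yields the series of the theorem. *)
Lemma block_gf (P Q : pred word) :
  (forall w, reduces_to_step w -> -1 <= depth w -> P w = Q w) ->
  word_gf (fun w => (P w)%:R * block_weight S w) =
  xvar *+ P [:: U] + xvar *+ P [:: D] + (xvar * zvar) *+ P [:: H] + cluster_gf S Q.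
Proof.
move=> PQ; rewrite -letter_gf cluster_gfE -word_gfD; apply: eq_word_gf => w.
rewrite block_weightE // mulrDr; congr (_ + _).
have [->|nz] := eqVneq (cluster_weight S w) 0; first by rewrite !mulr0.
by have [st dw] := cluster_weight_step nz; rewrite PQ.
Qed.

(** These series are the coefficients of the system; the [path_gf h] below are its unknowns N_h. *)
Definition step_gf h h' := word_gf (fun w => (walk h w == Some h')%:R * block_weight S w).

Definition path_gf h :=
  word_gf (fun w => (walk h w == Some 0%N)%:R * marked_weight S w).

Lemma step_gf_up h : step_gf h h.+1 = xvar +
  cluster_gf S (fun w => reduces_to_up w && ((0 < h)%N || (depth w == 0))).
Proof.
rewrite /step_gf (block_gf
  (Q := fun w => reduces_to_up w && ((0 < h)%N || (depth w == 0)))).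
  rewrite [walk _ _]/= [walk _ [:: D]]/= [walk _ [:: H]]/=; congr (_ + _).
  by case: h => [|h]; rewrite !(inj_eq (@Some_inj _)) ?eqxx ?ltn_eqF ?mulr0n ?addr0 //.
move=> w _ dw; have [red|nred] := boolP (reduces_to_up w); first exact: walk_up.
by apply: contraNF nred => /eqP/walk_height hw; apply/eqP; lia.
Qed.

Lemma step_gf_horizontal h : step_gf h h = xvar * zvar +
  cluster_gf S (fun w => reduces_to_horizontal w && ((0 < h)%N || (depth w == 0))).
Proof.
rewrite /step_gf (block_gf
  (Q := fun w => reduces_to_horizontal w && ((0 < h)%N || (depth w == 0)))).
  rewrite [walk _ _]/= [walk _ [:: D]]/= [walk _ [:: H]]/=; congr (_ + _).
  by case: h => [|h]; rewrite !(inj_eq (@Some_inj _)) ?eqxx ?(gtn_eqF (ltnSn _))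
    ?(ltn_eqF (ltnSn _)) /= !mulr0n !add0r.
move=> w _ dw; have [red|nred] := boolP (reduces_to_horizontal w); first exact: walk_horizontal.
by apply: contraNF nred => /eqP/walk_height hw; apply/eqP; lia.
Qed.

Lemma step_gf_down h : step_gf h.+1 h = xvar +
  cluster_gf S (fun w => reduces_to_down w && ((0 < h)%N || (depth w == 0))).
Proof.
rewrite /step_gf (block_gf
  (Q := fun w => reduces_to_down w && ((0 < h)%N || (depth w == 0)))).
  rewrite [walk _ _]/= [walk _ [:: D]]/= [walk _ [:: H]]/=; congr (_ + _).
  by rewrite !(inj_eq (@Some_inj _)) eqxx !gtn_eqF // addr0 add0r.
move=> w _ dw; have [red|nred] := boolP (reduces_to_down w); first exact: walk_down.
by apply: contraNF nred => /eqP/walk_height hw; apply/eqP; lia.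
Qed.

Definition neighbours h := if h is k.+1 then [:: k; k.+1; k.+2] else [:: 0; 1]%N.

Lemma walk_neighbours h h' w : reduces_to_step w -> walk h w = Some h' ->
  h' \in neighbours h.
Proof.
rewrite /reduces_to_step /reduces_to_up /reduces_to_down /reduces_to_horizontal.
move=> st /walk_height hw; move: st; rewrite hw.
by case: h {hw} => [|h]; rewrite /= !inE; lia.
Qed.

(** The first block leads from level [h] to a neighbouring level, from which the rest of the marked
    word is an arbitrary path to level 0. *)
Lemma path_gf_rec h : path_gf h =
  (h == 0%N)%:R + \sum_(h' <- neighbours h) step_gf h h' * path_gf h'.
Proof.
pose Nw h w : Qtz := (walk h w == Some 0%N)%:R * marked_weight S w.
pose Bw h' w : Qtz := (walk h w == Some h')%:R * block_weight S w.
transitivity (word_gf (fun w => (h == 0%N)%:R * (w == [::])%:R +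
    \sum_(h' <- neighbours h) wconv (Bw h') (Nw h') w)).
  apply: eq_word_gf => w; rewrite {1}marked_weight_conv mulrDr; congr (_ + _).
    by case: w => [|a w] //; rewrite !mulr0.
  rewrite /wconv exchange_big mulr_sumr /=; apply: eq_bigr => i _.
  rewrite /Bw /Nw -{1}(cat_take_drop i w) walk_cat.
  (* A prefix of nonzero weight reduces to a step, so its end level [k] is among the neighbours and
     only the summand for [k] survives. *)
  have [->|/block_weight_step[st _]] := eqVneq (block_weight S (take i w)) 0.
    by rewrite mul0r mulr0 big1 // => k _; rewrite mulr0 mul0r.
  case def_k: (walk h (take i w)) => [k|] /=; last first.
    by rewrite mul0r big1 // => k _; rewrite !mul0r.
  have kh := walk_neighbours st def_k.
  rewrite (bigD1_seq k) //=; last by case: (h) => [|h'] /=; rewrite ?inE; lia.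
  rewrite eqxx mul1r big1 ?addr0 => [|k' nk]; first by rewrite mulrCA.
  by rewrite (inj_eq (@Some_inj _)) eq_sym (negPf nk) !mul0r.
rewrite word_gfD; congr (_ + _).
  case: (h == 0%N) => /=.
    apply: etrans (word_gf_nil _ _).
    by apply: eq_word_gf => w; rewrite mul1r.
  by apply/fpsP => n; rewrite /= -big_tuple_wsum big1 // => w _; rewrite mul0r.
rewrite -(eq_bigr _ (fun h' _ => word_gf_conv (Bw h') (Nw h'))).
apply/fpsP => n; rewrite /= wsum_sum.
by elim: (neighbours h) => [|k s IHs]; rewrite ?big_nil // !big_cons IHs.
Qed.

End PathSystem.

(** * Solving the system *)

Lemma shift_t_motzkin_gf S : shift_t (motzkin_gf S) = path_gf S 0.
Proof.
apply/fpsP => n; rewrite /= -big_tuple_wsum raddf_sum big_mkcond /=.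
apply: eq_bigr => w _; rewrite motzkin_walk; case: eqP => _; rewrite ?mul0r ?mul1r //.
rewrite /tz_monom comp_polyM comp_polyC rmorphXn /= comp_polyX.
rewrite -sum_fpowerset_expr mulr_suml; apply: eq_bigr => M _.
by [].
Qed.

Lemma motzkin_system (R : idomainType) (l l' y y' s s' : fps R) (N : nat -> fps R) :
  2%:R \is a @GRing.unit R ->
  fpscoef l 0 = 0 -> fpscoef y 0 = 0 -> fpscoef s 0 = 0 ->
  N 0%N = 1 + l' * N 0%N + y' * N 1%N ->
  N 1%N = s' * N 0%N + l * N 1%N + y * N 2%N ->
  (forall h, N h.+2 = s * N h.+1 + l * N h.+2 + y * N h.+3) ->
  N 0%N * (2%:R * (1 - l') * y * s - y' * s' + y' * s' * l
           + y' * s' * fps_sqrt ((1 - l) ^+ 2 - 4%:R * y * s)) = 2%:R * y * s.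
Proof.
move=> u2 l0 y0 s0 N0 N1 NS.
have ys0 : fpscoef (y * s) 0 = 0 by rewrite coef_fpsM big_ord1 y0 mul0r.
have [C defC] := fps_quadratic_fixpoint l0 ys0.
(* The difference between the solution and the expected form at level h + 1. The quadratic equation
   for [C] cancels the contribution s' N_0, so [d] satisfies the homogeneous system. *)
pose d h := N h.+1 - C ^+ h.+1 * s ^+ h * s' * N 0%N.
have d0 : d 0%N = 0.
  apply: (fps_tridiagonal_eq0 l0 y0 s0) => [|h]; rewrite /d.
    by rewrite {1}N1 !expr1 {1}defC; ring.
  rewrite {1}NS [in LHS](exprS C) {1}defC !exprS; ring.
have {d d0}defN1 : N 1%N = C * s' * N 0%N.
  by apply/eqP; rewrite -subr_eq0 -d0 /d expr1 expr0 mulr1.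
have := quadratic_fps_sqrt u2 l0 ys0 defC; rewrite -[4%:R * y * s]mulrA.
move: (fps_sqrt _) => r defr.
(* With this value of the root the second factor becomes 2ys(1 - l' - y's'C). *)
have {}defr : r = 1 - l - 2%:R * (y * s) * C by rewrite defr; ring.
rewrite defr; move: N0; rewrite defN1 => N0.
transitivity (2%:R * y * s * (N 0%N - l' * N 0%N - y' * (C * s' * N 0%N))).
  by ring.
by rewrite {1}N0; ring.
Qed.

Lemma eq_cluster_gf S (P Q : pred word) : P =1 Q -> cluster_gf S P = cluster_gf S Q.
Proof. by move=> PQ; apply/fpsP => n; apply: eq_bigl => w; apply: PQ. Qed.

(** Every cluster has a mark, so it contributes only positive powers of t and cannot cancel the term
    x, whose t-degree is 0. *)
Lemma xvar_cluster_gf_neq0 S (P : pred word) :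
  [::] \notin S -> xvar + cluster_gf S P != 0.
Proof.
move=> S0; apply/eqP => /fpsP/(_ 1%N)/(congr1 (fun p : Qtz => p`_0))/eqP.
rewrite coef_fpsD coef_fps0 coefD coef0 /= coef1 coef_sum big1 ?addr0 ?oner_eq0 // => w _.
rewrite coef_sum big1 // => M /(clusterP _ _ S0)[_ _ M0 _].
by rewrite /tz_monom coef0M coefXn eq_sym cardfs_eq0 (negPf M0) mul0r.
Qed.

Theorem theorem7p1 (S : {fset word})
  (S_nonempty_words : [::] \notin S)
  (S_reduced : forall v w : word, v \in S -> w \in S -> infix v w -> v = w)
  (S_clusters : forall (w : word) (M : {fset nat * word}),
     cluster S w M -> reduces_to_step w /\ -1 <= depth w) :
  let x := xvar in
  let z := zvar in
  let l := x * z + A_H S in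
  let l' := x * z + A'_H S in
  let y := x + A_U S in
  let y' := x + A'_U S in
  let s := x + A_D S in
  let s' := x + A'_D S in
  tofrac (shift_t (motzkin_gf S)) =
    tofrac (2%:R * y * s) /
    tofrac (2%:R * (1 - l') * y * s - y' * s' + y' * s' * l
            + y' * s' * fps_sqrt ((1 - l) ^+ 2 - 4%:R * y * s))
    :> {fraction fps Qtz}.
Proof.
move=> x z l l' y y' s s'; rewrite shift_t_motzkin_gf.
(* When the lower endpoint is above level 0, the depth condition disappears and the unprimed series
   result. *)
have upS h : step_gf S h.+1 h.+2 = y.
  by rewrite step_gf_up //; congr (_ + _); apply: eq_cluster_gf => w; rewrite andbT.
have downS h : step_gf S h.+2 h.+1 = s.
  by rewrite step_gf_down //; congr (_ + _); apply: eq_cluster_gf => w; rewrite andbT.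
have horS h : step_gf S h.+1 h.+1 = l.
  by rewrite step_gf_horizontal //; congr (_ + _); apply: eq_cluster_gf => w; rewrite andbT.
have l0 : fpscoef l 0 = 0.
  by rewrite coef_fpsD cluster_gf_coef0 addr0 coef_fpsM big_ord1 mul0r.
have y0 : fpscoef y 0 = 0 by rewrite coef_fpsD cluster_gf_coef0 addr0.
have s0 : fpscoef s 0 = 0 by rewrite coef_fpsD cluster_gf_coef0 addr0.
have N0 : path_gf S 0 = 1 + l' * path_gf S 0 + y' * path_gf S 1.
  rewrite {1}path_gf_rec // !big_cons big_nil addr0 addrA.
  by rewrite step_gf_horizontal // step_gf_up.
have N1 : path_gf S 1 = s' * path_gf S 0 + l * path_gf S 1 + y * path_gf S 2.
  rewrite {1}path_gf_rec // !big_cons big_nil addr0 add0r addrA horS upS.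
  by rewrite step_gf_down.
have NS h : path_gf S h.+2 =
    s * path_gf S h.+1 + l * path_gf S h.+2 + y * path_gf S h.+3.
  by rewrite {1}path_gf_rec // !big_cons big_nil addr0 add0r addrA horS upS downS.
have sys := motzkin_system Qtz_unit2 l0 y0 s0 N0 N1 NS.
(* The system gives N_0 times [den] as 2ys. Since 2ys is nonzero, so is [den], and the division in
   the fraction field is legitimate. *)
set den := (X in _ / tofrac X); rewrite -sys rmorphM mulfK // tofrac_eq0.
have : 2%:R * y * s != 0.
  rewrite !mulf_neq0 ?xvar_cluster_gf_neq0 //.
  apply/eqP => /fpsP/(_ 0%N) e; have := Qtz_unit2.
  by rewrite -[2%:R]/(fpscoef (2%:R : fps Qtz) 0) e unitr0.
by rewrite -sys mulf_eq0 negb_or => /andP[].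
Qed.
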